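(* Let $r\ge 1$ and let $A\in\mathcal{M}_r$, $R,S\in\mathcal{S}_r^0$ be such that $(A,S^{1/2})$ is observable and $(A,R^{1/2})$ is controllable. Then there exists a family of maps $\mathbb{C}_t:\mathcal{S}_r^0\to GL_r(\mathbb{R})$, $t\ge 0$, each affine in its argument $Q$, such that for every $t\ge 0$ and every $Q\in\mathcal{S}_r^0$, $$E_t(Q)=e^{tB}\,\mathbb{C}_t(Q)^{-1},\qquad \sup_{u\ge 0}\Vert \mathbb{C}_u(Q)^{-1}\Vert<\infty ,\qquad \mathbb{C}_t(P_\infty)=I .$$ In particular $E_t(P_\infty)=e^{tB}$.
   Context: Notation: $\mathcal{M}_r=\mathbb{R}^{r\times r}$; $\mathcal{S}_r^0$ and $\mathcal{S}_r^+$ are the sets of real symmetric positive semi-definite, respectively positive definite, $r\times r$ matrices; $A'$ is the transpose of $A$; $\Vert\cdot\Vert$ is the spectral norm; $GL_r(\mathbb{R})$ is the group of invertible matrices in $\mathcal{M}_r$. $S^{1/2},R^{1/2}$ are symmetric square roots. Observability of $(A,S^{1/2})$ means that the matrix obtained by stacking $S^{1/2},S^{1/2}A,\dots,S^{1/2}A^{r-1}$ has rank $r$; controllability of $(A,R^{1/2})$ means that $[R^{1/2},AR^{1/2},\dots,A^{r-1}R^{1/2}]$ has rank $r$. Riccati flow: $\Lambda(P):=AP+PA'+R-PSP$. For $Q\in\mathcal{S}_r^0$, $t\mapsto\phi_t(Q)\in\mathcal{S}_r^0$, $t\ge 0$, is the (globally defined) solution of $\partial_t\phi_t(Q)=\Lambda(\phi_t(Q))$,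 $\phi_0(Q)=Q$. Exponential semigroup: $E_t(Q)$, $t\ge0$, is the solution of $\partial_tE_t(Q)=(A-\phi_t(Q)S)E_t(Q)$ with $E_0(Q)=I$. Fixed point: under the observability and controllability assumptions there is a unique $P_\infty\in\mathcal{S}_r^+$ such that $\Lambda(P_\infty)=0$ and $B:=A-P_\infty S$ is Hurwitz (all eigenvalues have negative real part). *)

(* Defs.v *)
From HB Require Import structures.
From mathcomp Require Import all_boot all_order all_algebra.
From mathcomp.real_closed Require Import complex.
From mathcomp Require Import all_classical all_reals all_analysis.

Set Implicit Arguments.
Unset Strict Implicit.
Unset Printing Implicit Defensive.

Import Order.TTheory GRing.Theory Num.Theory.
Import numFieldNormedType.Exports.

Local Open Scope classical_set_scope.
Local Open Scope ring_scope.

Section Matrices.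
Context {K : realType} {r : nat}.
Implicit Types (A B M P Q R S : 'M[K]_r) (v : 'cV[K]_r).

Definition symmetric_psd M : Prop :=
  M^T = M /\ forall v, 0 <= (v^T *m M *m v) 0 0.

Definition symmetric_pd M : Prop :=
  M^T = M /\ forall v, v != 0 -> 0 < (v^T *m M *m v) 0 0.

(* No sign condition: a symmetric matrix may have several such roots. *)
Definition symmetric_sqrt M Mh : Prop := Mh^T = Mh /\ Mh *m Mh = M.

Definition observable A M : Prop :=
  \rank (\mxcol_(k < r) (M *m A ^+ k)) = r.

Definition controllable A M : Prop :=
  \rank (\mxrow_(k < r) (A ^+ k *m M)) = r.

(* The eigenvalues are the complex ones. *)
Definition hurwitz B : Prop :=
  forall z : K[i],
    eigenvalue (map_mx (real_complex K) B) z -> complex.Re z < 0.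

Definition euclidean_norm v : K := Num.sqrt ((v^T *m v) 0 0).

(* The library norm on matrices is the largest absolute value of an entry;
   the spectral norm is the operator norm for the Euclidean norm. *)
Definition spectral_norm M : K :=
  sup [set euclidean_norm (M *m v) | v in [set v | euclidean_norm v <= 1]].

Definition expmx M : 'M[K]_r :=
  limn (series (fun n => n`!%:R^-1 *: M ^+ n)).

(* The restriction to D of an affine map of the space of all matrices. *)
Definition affine_on (D : set 'M[K]_r) (f : 'M[K]_r -> 'M[K]_r) : Prop :=
  exists (L : {linear 'M[K]_r -> 'M[K]_r}) (M : 'M[K]_r),
    forall Q, D Q -> f Q = L Q + M.

(* x' = F(t, x) on [0, +oo[ with x(0) = x0; the derivative at 0 is one-sided,
   so the values of x at negative times play no role. *)
Definition ode_solution (F : K -> 'M[K]_r -> 'M[K]_r) (x0 : 'M[K]_r)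
    (x : K -> 'M[K]_r) : Prop :=
  [/\ x 0 = x0,
      h^-1 *: (x h - x 0) @[h --> 0^'+] --> F 0 (x 0) &
      forall t : K, 0 < t -> is_derive t 1 x (F t (x t))].

Definition riccati A R S P : 'M[K]_r := A *m P + P *m A^T + R - P *m S *m P.

Definition riccati_flow A R S (phi : K -> 'M[K]_r -> 'M[K]_r) : Prop :=
  forall Q, symmetric_psd Q ->
    (forall t, 0 <= t -> symmetric_psd (phi t Q)) /\
    ode_solution (fun _ P => riccati A R S P) Q (phi ^~ Q).

Definition exponential_semigroup A S (phi E : K -> 'M[K]_r -> 'M[K]_r) : Prop :=
  forall Q, symmetric_psd Q ->
    ode_solution (fun t X => (A - phi t Q *m S) *m X) 1%:M (E ^~ Q).

Definition riccati_fixed_point A R S Pinf : Prop :=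
  [/\ symmetric_pd Pinf, riccati A R S Pinf = 0 & hurwitz (A - Pinf *m S)].

End Matrices.

(* Main.v *)
(* Put [G 0 = 0], [G' = (e^{tB})^T S e^{tB}] and [C_t(Q) = 1 + (Q - P) G_t].
   The identity [phi_t(Q) - P = E_t(Q) (Q - P) (e^{tB})^T] shows that
   [X = e^{-tB} E_t(Q)] solves [X' = - X C' X], hence [X C_t(Q) = 1].
   The bound needs no spectral argument: multiplying the Riccati equation for [P]
   by [P^-1] on both sides and integrating along [e^{tB}] gives
     [P^-1 = G_t + (e^{tB})^T P^-1 e^{tB} + H_t]
   with [H_t] nondecreasing and, by controllability, [H_1] positive definite.
   So [P^-1 - G_t >= c P^-1] uniformly in [t], which bounds the inverse of
   [1 + (Q - P) G_t] for every positive semi-definite [Q]. *)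
Require Import Defs.
From mathcomp Require Import all_boot all_order all_algebra.
From mathcomp Require Import all_classical all_reals all_analysis.
From mathcomp Require Import ring lra.

Set Implicit Arguments.
Unset Strict Implicit.
Unset Printing Implicit Defensive.

Import Order.TTheory GRing.Theory Num.Theory.
Import numFieldNormedType.Exports.

Local Open Scope classical_set_scope.
Local Open Scope ring_scope.

(** * Entrywise calculus of matrix curves, linear uniqueness and primitives *)

Section MatrixCalculus.
Context {K : realType}.

Lemma is_derive_mxP m n (X : K -> 'M[K]_(m, n)) (t : K) D :
  is_derive t 1 X D <-> forall i j, is_derive t 1 (fun s => X s i j) (D i j).
Proof.
split=> [dX i j|dX].
  have /derivable_mxP dXij : derivable X t 1 by [].
  apply: DeriveDef; first exact: dXij.
  by rewrite -(@derive_val _ _ _ t 1 X D) derive_mx ?mxE.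
have dXt : derivable X t 1 by apply/derivable_mxP => i j; case: (dX i j).
apply: DeriveDef => //; rewrite derive_mx//; apply/matrixP => i j.
by rewrite mxE derive_val.
Qed.

Lemma cvg_mx (T : Type) (F : set_system T) (FF : Filter F) m n
    (X : T -> 'M[K]_(m, n)) (L : 'M[K]_(m, n)) :
  (forall i j, X s i j @[s --> F] --> L i j) -> X s @[s --> F] --> L.
Proof.
move=> cX; apply/cvgrPdist_le => /= e e0; near=> s.
rewrite [leLHS]/Num.Def.normr/= mx_normrE (bigmax_le _ (ltW e0))//= => -[i j] _.
rewrite !mxE/=; move: i j; near: s.
apply: filter_forall => i; apply: filter_forall => j.
exact: ((cvgrPdist_le _ _).1 (cX i j)).
Unshelve. all: by end_near. Qed.

Lemma continuous_mxP (T : topologicalType) m n (X : T -> 'M[K]_(m, n)) :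
  continuous X <-> forall i j, continuous (fun s => X s i j).
Proof.
split=> [cX i j t|cX t].
  exact: (@continuous_comp _ _ _ X (fun M : 'M[K]_(m, n) => M i j) t (cX t)
    (@coord_continuous K m n i j (X t))).
by apply: cvg_mx => i j; exact: cX.
Qed.

Lemma is_derive_mulmx m n p (X : K -> 'M[K]_(m, n)) (Y : K -> 'M[K]_(n, p))
    (t : K) DX DY :
  is_derive t 1 X DX -> is_derive t 1 Y DY ->
  is_derive t 1 (fun s => X s *m Y s) (DX *m Y t + X t *m DY).
Proof.
move=> /is_derive_mxP dX /is_derive_mxP dY; apply/is_derive_mxP => i j.
rewrite (_ : (fun s => _) =
    \sum_(k < n) ((fun s => X s i k) * (fun s => Y s k j))); last first.
  by apply/funext => s; rewrite mxE fct_sumE.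
apply: is_derive_eq.
rewrite !mxE -big_split/=; apply: eq_bigr => k _.
by rewrite addrC; congr (_ + _); rewrite mulrC.
Qed.

Lemma is_derive_trmx m n (X : K -> 'M[K]_(m, n)) (t : K) DX :
  is_derive t 1 X DX -> is_derive t 1 (fun s => (X s)^T) DX^T.
Proof.
move=> /is_derive_mxP dX; apply/is_derive_mxP => i j.
rewrite [X in is_derive _ _ X _](_ : _ = (fun s => X s j i)); last first.
  by apply/funext => s; rewrite mxE.
by rewrite mxE.
Qed.

Lemma is_derive_mulmxl m n p (L : 'M[K]_(m, n)) (X : K -> 'M[K]_(n, p)) (t : K)
    DX :
  is_derive t 1 X DX -> is_derive t 1 (fun s => L *m X s) (L *m DX).
Proof.
move=> dX; have := is_derive_mulmx (is_derive_cst L t 1) dX.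
by rewrite mul0mx add0r.
Qed.

Lemma is_derive_mulmxr m n p (X : K -> 'M[K]_(m, n)) (L : 'M[K]_(n, p)) (t : K)
    DX :
  is_derive t 1 X DX -> is_derive t 1 (fun s => X s *m L) (DX *m L).
Proof.
move=> dX; have := is_derive_mulmx dX (is_derive_cst L t 1).
by rewrite mulmx0 addr0.
Qed.

Lemma continuous_mulmx (T : topologicalType) m n p (X : T -> 'M[K]_(m, n))
    (Y : T -> 'M[K]_(n, p)) :
  continuous X -> continuous Y -> continuous (fun s => X s *m Y s).
Proof.
move=> /continuous_mxP cX /continuous_mxP cY; apply/continuous_mxP => i j t.
rewrite [X in continuous_at _ X](_ : _ =
    fun s => \sum_(k < n) X s i k * Y s k j); last first.
  by apply/funext => s; rewrite mxE.
apply: cvg_big => [|k _]; first exact: add_continuous.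
by apply: cvgM; [exact: cX|exact: cY].
Qed.

Lemma continuous_trmx (T : topologicalType) m n (X : T -> 'M[K]_(m, n)) :
  continuous X -> continuous (fun s => (X s)^T).
Proof.
move=> /continuous_mxP cX; apply/continuous_mxP => i j.
rewrite [X in continuous X](_ : _ = (fun s => X s j i)); last first.
  by apply/funext => s; rewrite mxE.
exact: cX.
Qed.

Lemma is_derive_continuous (V : normedModType K) (f df : K -> V) :
  (forall t : K, is_derive t 1 f (df t)) -> continuous f.
Proof.
move=> dfx t; apply: differentiable_continuous; apply/derivable1_diffP.
by case: (dfx t).
Qed.

(** Serves to differentiate an identity that is known only on an open interval. *)
Lemma near_eq0_derive0 (V : normedModType K) (f : K -> V) (df : V) (t : K) :
  is_derive t 1 f df -> (\forall s \near t, f s = 0) -> df = 0.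
Proof.
move=> dft f0; have d0 : is_derive t 1 (cst 0 : K -> V) df.
  exact: near_eq_is_derive dft.
by rewrite -(@derive_val _ _ _ _ _ _ _ d0) derive_cst.
Qed.

Lemma derive_ge0_le (f df : K -> K) (a b : K) : a <= b ->
  continuous f -> (forall t, a < t < b -> is_derive t 1 f (df t)) ->
  (forall t, a < t < b -> 0 <= df t) -> f a <= f b.
Proof.
rewrite le_eqVlt => /predU1P[->//|ab] cf dfx df0.
have dfi x : x \in `]a, b[ -> is_derive x 1 f (df x).
  by rewrite in_itv; exact: dfx.
have [c cab fE] := MVT ab dfi (continuous_subspaceT cf).
rewrite in_itv in cab.
by rewrite -subr_ge0 fE mulr_ge0 ?subr_ge0 ?(ltW ab)// df0.
Qed.

(** The product [f t * expR (- c * t)] is nonincreasing; [g] is its opposite, so that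
    [derive_ge0_le] applies. *)
Lemma gronwall_le0 (f df : K -> K) (c b : K) : 0 <= b ->
  continuous f -> f 0 = 0 ->
  (forall t, 0 < t < b -> is_derive t 1 f (df t)) ->
  (forall t, 0 < t < b -> df t <= c * f t) -> f b <= 0.
Proof.
move=> b0 cf f0 dfx dfle.
pose g t := - (f t * expR (- c * t)).
pose dg t := (c * f t - df t) * expR (- c * t).
have dexp (t : K) :
    is_derive t 1 (fun s => expR (- c * s)) (- c * expR (- c * t)).
  have dc : is_derive t 1 (fun s : K => - c * s) (- c).
    have := is_deriveZ (- c) (is_derive_id t (1 : K)).
    by rewrite /GRing.scale/= mulr1.
  by have := is_derive1_comp (is_derive_expR (- c * t)) dc; rewrite mulrC.
have dgx t : 0 < t < b -> is_derive t 1 g (dg t).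
  move=> /dfx dft; apply: (is_derive_eq (is_deriveN (is_deriveM dft (dexp t)))).
  by rewrite /dg /GRing.scale/=; ring.
have cg : continuous g.
  move=> t; apply: cvgN; apply: cvgM; first exact: cf.
  exact: (is_derive_continuous dexp).
have : g 0 <= g b.
  apply: (derive_ge0_le b0 cg dgx) => t t0b.
  by rewrite mulr_ge0 ?expR_ge0// subr_ge0 dfle.
by rewrite /g f0 mul0r oppr0 oppr_ge0 pmulr_lle0 ?expR_gt0.
Qed.

Lemma continuous_itv_bounded (f : K -> K) (a b : K) : continuous f ->
  exists2 M, 0 <= M & forall t, a <= t <= b -> `|f t| <= M.
Proof.
move=> cf; have [ab|ba] := leP a b; last first.
  exists 0 => // t /andP[at_ tb]; have := le_trans at_ tb.
  by rewrite leNgt ba.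
have cnf : continuous (fun t => `|f t|).
  by move=> t; apply: cvg_norm; exact: cf.
have [c _ fc] := @EVT_max K (fun t => `|f t|) a b ab (continuous_subspaceT cnf).
by exists `|f c| => // t tab; apply: fc; rewrite in_itv.
Qed.

Lemma continuous_mx_bounded m n (X : K -> 'M[K]_(m, n)) (a b : K) :
  continuous X ->
  exists2 M, 0 <= M & forall t i j, a <= t <= b -> `|X t i j| <= M.
Proof.
move=> /continuous_mxP cX.
have /choice[F HF] (ij : 'I_m * 'I_n) : exists M : K,
    0 <= M /\ forall t, a <= t <= b -> `|X t ij.1 ij.2| <= M.
  by have [M M0 HM] := @continuous_itv_bounded _ a b (cX ij.1 ij.2); exists M.
exists (\sum_ij F ij) => [|t i j tab].
  by apply: sumr_ge0 => ij _; case: (HF ij).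
rewrite (bigD1 (i, j))//= (le_trans ((HF (i, j)).2 t tab))// lerDl.
by apply: sumr_ge0 => ij _; case: (HF ij).
Qed.

(** Energy argument: the sum [f] of the squared entries of [W] satisfies [f' <= c f] and [f 0 = 0],
    so Gronwall forces it to vanish. The uniqueness arguments on the half-line all reduce to this
    linear case. *)
Lemma linear_ode_eq0 m n (U : K -> 'M[K]_m) (W : K -> 'M[K]_(m, n)) :
  continuous U -> continuous W -> W 0 = 0 ->
  (forall t : K, 0 < t -> is_derive t 1 W (U t *m W t)) ->
  forall t, 0 <= t -> W t = 0.
Proof.
move=> cU cW W0 dW b b0.
have [u u0 Hu] := @continuous_mx_bounded _ _ U 0 b cU.
have /continuous_mxP cWij := cW.
pose f t := \sum_ij W t ij.1 ij.2 ^+ 2.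
pose df t := \sum_ij 2 * W t ij.1 ij.2 * (U t *m W t) ij.1 ij.2.
have f_ge t i j : W t i j ^+ 2 <= f t.
  rewrite /f (bigD1 (i, j))//= lerDl.
  by apply: sumr_ge0 => ij _; exact: sqr_ge0.
have dfx t : 0 < t < b -> is_derive t 1 f (df t).
  move=> /andP[/dW/is_derive_mxP dWt _].
  (* The sum over pairs is reindexed by an ordinal, the form in which the differentiation rule for
     sums applies. *)
  rewrite [X in is_derive _ _ X _](_ : _ =
      \sum_(k < #|{: 'I_m * 'I_n}|)
        (fun s => W s (enum_val k).1 (enum_val k).2) ^+ 2); last first.
    by apply/funext => s; rewrite /f fct_sumE big_enum_val/=.
  apply: is_derive_eq; rewrite /df [RHS]big_enum_val/=.
  by apply: eq_bigr => k _; rewrite expr1.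
have cf : continuous f.
  move=> t; apply: cvg_big => [|ij _]; first exact: add_continuous.
  by rewrite expr2; under eq_fun do rewrite expr2; apply: cvgM; exact: cWij.
(* For entries [x], [y] of [W], |x y| <= (x^2 + y^2) / 2 <= f, so each product of entries in [df] is
   at most 2 u f; [c] adds these bounds over all [i], [j], [k]. *)
pose c := \sum_(ij : 'I_m * 'I_n) \sum_(k < m) 2 * u.
have : f b <= 0.
  apply: (@gronwall_le0 f df c) => //.
    by rewrite /f big1// => ij _; rewrite W0 mxE expr0n.
  move=> t /andP[t0 tb]; rewrite /df /c mulr_suml; apply: ler_sum => -[i j] _/=.
  rewrite mxE mulr_sumr mulr_suml; apply: ler_sum => k _.
  have := f_ge t i j; have := f_ge t k j.
  have : `|U t i k| <= u by apply: Hu; rewrite !ltW.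
  move: (U t i k) (W t i j) (W t k j) (f t) => p x y z pu yz xz.
  have xyz : `|x * y| <= z.
    by rewrite ler_norml; have := sqr_ge0 (x + y); have := sqr_ge0 (x - y); lra.
  have : p * (x * y) <= u * z.
    by rewrite (le_trans (ler_norm _))// normrM ler_pM.
  lra.
move=> fb; apply/matrixP => i j; rewrite mxE; apply/eqP.
by rewrite -sqrf_eq0 eq_le sqr_ge0 (le_trans (f_ge b i j)).
Qed.

(** The integral starts at [-1] so that [0] is interior and [H] is continuous there. Composing with
    the absolute value keeps the argument of [H] nonnegative and changes nothing at positive
    times. *)
Lemma continuous_primitive (f : K -> K) : continuous f ->
  exists F : K -> K, [/\ continuous F, F 0 = 0 &
    forall t : K, 0 < t -> is_derive t 1 F (f t)].
Proof.
move=> cf; pose H (x : K) : K := (\int[lebesgue_measure]_(t in `[-1, x]) f t)%R.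
have dH (x : K) : -1 < x -> is_derive x 1 H (f x).
  move=> x1; have xx1 : x < x + 1 by rewrite ltrDl.
  have fi : (@lebesgue_measure K).-integrable `[-1, x + 1] (EFin \o f).
    apply: continuous_compact_integrable; first exact: segment_compact.
    exact: continuous_subspaceT.
  have [dHx <-] := continuous_FTC1_closed xx1 fi x1 (cf x).
  by rewrite derive1E; exact: derivableP.
have cH (x : K) : -1 < x -> {for x, continuous H}.
  move=> /dH[dHx _]; apply: differentiable_continuous.
  exact/derivable1_diffP.
exists (fun t => H `|t| - H 0); split=> [t||t t0].
- apply: cvgB; last exact: cvg_cst.
  apply: continuous_cvg; last exact: norm_continuous.
  by apply: cH; rewrite (lt_le_trans _ (normr_ge0 _))// oppr_lt0.
- by rewrite normr0 subrr.
have dHt : is_derive t 1 (fun s => H s - H 0) (f t).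
  have := is_deriveB (dH t (lt_trans (ltrN10 K) t0)) (is_derive_cst (H 0) t 1).
  by rewrite subr0.
apply: near_eq_is_derive dHt; near=> s; rewrite ger0_norm//.
by apply: ltW; near: s; exact: lt_nbhsr.
Unshelve. all: by end_near. Qed.

Lemma mx_derive0_cst m n (X : K -> 'M[K]_(m, n)) :
  (forall t : K, is_derive t 1 X 0) -> forall s t, X s = X t.
Proof.
move=> dX s t; apply/matrixP => i j.
apply: (@is_derive_0_is_cst K (fun x => X x i j)) => x.
by have /is_derive_mxP/(_ i j) := dX x; rewrite mxE.
Qed.

End MatrixCalculus.

(** * The matrix exponential through entrywise power series *)

Section MatrixExponential.
Context {K : realType} {r : nat}.
Implicit Types M N : 'M[K]_r.

(** Taking for [a] the sum of the absolute values of all entries is enough to dominate the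
    exponential series entry by entry. *)
Lemma expr_mx_bounded M :
  exists2 a : K, 0 <= a & forall n i j, `|(M ^+ n) i j| <= a ^+ n.
Proof.
pose a := \sum_i \sum_k `|M i k|.
have s0 i : 0 <= \sum_k `|M i k| by exact: sumr_ge0.
have a0 : 0 <= a by exact: sumr_ge0.
exists a => // n; elim: n => [|n IHn] i j.
  by rewrite !expr0 mxE; case: eqP => _; rewrite ?normr1// normr0.
rewrite exprS mxE (le_trans (ler_norm_sum _ _ _))// exprS.
apply: (@le_trans _ _ ((\sum_k `|M i k|) * a ^+ n)).
  by rewrite mulr_suml; apply: ler_sum => k _; rewrite normrM ler_wpM2l.
by rewrite ler_wpM2r ?exprn_ge0// [leRHS](bigD1 i)//= lerDl sumr_ge0.
Qed.

(** Partial sums of the entry (i, j) of N e^{zM}, as a power series in z. The left factor [N] makes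
    the family stable under differentiation, which replaces [N] by [N *m M]. *)
Definition mx_pseries N M (i j : 'I_r) : K -> K^nat :=
  pseries (fun n => n`!%:R^-1 * (N *m M ^+ n) i j).

Lemma is_cvg_mx_pseries N M i j z : cvgn (mx_pseries N M i j z).
Proof.
have [a a0 Ha] := expr_mx_bounded M.
pose b := \sum_k `|N i k|.
have b0 : 0 <= b by exact: sumr_ge0.
apply: normed_cvg; rewrite /normed_series_of/=.
(* Comparison with [b] times the scalar exponential series at a|z|. *)
apply: (@series_le_cvg K _ (b *: exp_coeff (a * `|z|))) => [n|n|n|].
- exact: normr_ge0.
- rewrite /= mulr_ge0// /exp_coeff/= divr_ge0// exprn_ge0//.
  by rewrite mulr_ge0.
- rewrite normrM normrM normrX (ger0_norm (_ : 0 <= n`!%:R^-1)) ?invr_ge0//.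
  have HN : `|(N *m M ^+ n) i j| <= b * a ^+ n.
    rewrite mxE (le_trans (ler_norm_sum _ _ _))// mulr_suml.
    by apply: ler_sum => k _; rewrite normrM ler_wpM2l.
  rewrite [leRHS](_ : _ = n`!%:R^-1 * (b * a ^+ n) * `|z| ^+ n); last first.
    by rewrite -[LHS]/(b * ((a * `|z|) ^+ n / n`!%:R)) exprMn; ring.
  by rewrite ler_wpM2r ?exprn_ge0// ler_wpM2l// invr_ge0.
- by apply: is_cvg_seriesZ; exact: is_cvg_series_exp_coeff.
Qed.

Lemma pseries_diffs_mx N M (i j : 'I_r) :
  pseries_diffs (fun n => n`!%:R^-1 * (N *m M ^+ n) i j) =
  fun n => n`!%:R^-1 * (N *m M *m M ^+ n) i j.
Proof.
apply/funext => n; rewrite /pseries_diffs exprS -mulmxA mulrA factS natrM invfM.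
by rewrite mulVKf// pnatr_eq0.
Qed.

Lemma is_derive_mx_pseries N M i j (z : K) :
  is_derive z 1 (fun x => limn (mx_pseries N M i j x))
    (limn (mx_pseries (N *m M) M i j z)).
Proof.
rewrite /mx_pseries -pseries_diffs_mx.
(* Termwise differentiation asks for convergence of the series and of its first two formal
   derivatives at some point of modulus greater than |z|. *)
apply: (@pseries_snd_diffs _ _ (`|z| + 1)).
- exact: is_cvg_mx_pseries.
- by rewrite pseries_diffs_mx; exact: is_cvg_mx_pseries.
- by rewrite !pseries_diffs_mx; exact: is_cvg_mx_pseries.
- by rewrite [ltRHS]ger0_norm ?addr_ge0// ltrDl.
Qed.

Lemma expr_scalemx (z : K) M n : (z *: M) ^+ n = z ^+ n *: M ^+ n.
Proof.
elim: n => [|n IHn]; first by rewrite !expr0 scale1r.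
by rewrite !exprS IHn -!mulmxE -scalemxAl -scalemxAr scalerA.
Qed.

Definition expmx_series M : nat -> 'M[K]_r :=
  series (fun n => n`!%:R^-1 *: M ^+ n).

Lemma mulmx_expmx_series N M (z : K) n i j :
  (N *m expmx_series (z *: M) n) i j = mx_pseries N M i j z n.
Proof.
rewrite /expmx_series /mx_pseries /pseries /series/= mulmx_sumr summxE.
apply: eq_bigr => k _; rewrite expr_scalemx -!scalemxAr 2!mxE.
by rewrite mulrCA mulrC.
Qed.

(** [expmx] is a [limn], which carries information only once the series converges; the limits of the
    entries provide the witness. *)
Lemma cvg_expmx M : expmx_series M @ \oo --> expmx M.
Proof.
suff : cvgn (expmx_series M) by [].
apply/cvg_ex; exists (\matrix_(i, j) limn (mx_pseries 1%:M M i j 1)).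
apply: cvg_mx => i j; rewrite mxE.
rewrite [X in X @ _ --> _](_ : _ = mx_pseries 1%:M M i j 1).
  exact: is_cvg_mx_pseries.
by apply/funext => n; rewrite -mulmx_expmx_series scale1r mul1mx.
Qed.

Lemma mulmx_expmx_entry N M (z : K) i j :
  (N *m expmx (z *: M)) i j = limn (mx_pseries N M i j z).
Proof.
apply/esym/cvg_lim => //.
rewrite [X in X @ _ --> _](_ : _ = fun n => (N *m expmx_series (z *: M) n) i j).
  2: by apply/funext => n; rewrite mulmx_expmx_series.
have /continuous_mxP/(_ i j) cN : continuous (fun X : 'M[K]_r => N *m X).
  by apply: (@continuous_mulmx _ _ _ _ _ (cst N) id) => X;
    [exact: cst_continuous|exact: cvg_id].
exact: (continuous_cvg _ (cN _) (@cvg_expmx (z *: M))).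
Qed.

Lemma expmx_comm M : M *m expmx M = expmx M *m M.
Proof.
have cl : continuous (mulmx M : 'M[K]_r -> 'M[K]_r).
  by apply: (@continuous_mulmx _ _ _ _ _ (cst M) id) => X;
    [exact: cst_continuous|exact: cvg_id].
have cr : continuous (mulmx^~ M : 'M[K]_r -> 'M[K]_r).
  by apply: (@continuous_mulmx _ _ _ _ _ id (cst M)) => X;
    [exact: cvg_id|exact: cst_continuous].
have Hl : M *m expmx_series M n @[n --> \oo] --> M *m expmx M.
  exact: (continuous_cvg _ (cl _) (@cvg_expmx M)).
have Hr : expmx_series M n *m M @[n --> \oo] --> expmx M *m M.
  exact: (continuous_cvg _ (cr _) (@cvg_expmx M)).
have E : (fun n => M *m expmx_series M n) = (fun n => expmx_series M n *m M).
  apply/funext => n; rewrite /expmx_series /series/= mulmx_sumr mulmx_suml.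
  apply: eq_bigr => k _; rewrite -scalemxAr -scalemxAl; congr (_ *: _).
  by rewrite !mulmxE -exprS -exprSr.
rewrite E in Hl; exact: cvg_unique Hl Hr.
Qed.

Lemma is_derive_expmx M (t : K) :
  is_derive t 1 (fun s => expmx (s *: M)) (M *m expmx (t *: M)).
Proof.
apply/is_derive_mxP => i j.
rewrite mulmx_expmx_entry -[M in mx_pseries M]mul1mx.
rewrite [X in is_derive _ _ X _](_ : _ =
    fun s => limn (mx_pseries 1%:M M i j s)).
  exact: is_derive_mx_pseries.
by apply/funext => s; rewrite -mulmx_expmx_entry mul1mx.
Qed.

Lemma continuous_expmx M : continuous (fun t : K => expmx (t *: M)).
Proof. exact: is_derive_continuous (is_derive_expmx M). Qed.

Lemma expmx0 : expmx (0 : 'M[K]_r) = 1%:M.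
Proof.
apply: cvg_lim => //; apply: cvg_near_cst; near=> n.
have n0 : (0 < n)%N by near: n; exists 1%N.
rewrite /series/= -(prednK n0) big_nat_recl// fact0 invr1 scale1r expr0.
by rewrite big1 ?addr0// => k _; rewrite expr0n scaler0.
Unshelve. all: by end_near. Qed.

Lemma expmxZ_comm M (t : K) : M *m expmx (t *: M) = expmx (t *: M) *m M.
Proof.
have [->|t0] := eqVneq t 0; first by rewrite scale0r expmx0 mulmx1 mul1mx.
apply: (scalerI t0).
by rewrite scalemxAl expmx_comm scalemxAr.
Qed.

(** The product has zero derivative, because [M] commutes with its exponential, and it is the
    identity at time 0. *)
Lemma expmx_mulVr M (t : K) : expmx (t *: M) *m expmx (t *: - M) = 1%:M.
Proof.
pose X (s : K) := expmx (s *: M) *m expmx (s *: - M).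
rewrite -/(X t) (mx_derive0_cst _ t 0).
  by rewrite /X !scale0r expmx0 mulmx1.
move=> s; apply: is_derive_eq.
  exact: is_derive_mulmx (is_derive_expmx _ _) (is_derive_expmx _ _).
by rewrite mulNmx mulmxN expmxZ_comm mulmxA subrr.
Qed.

Lemma expmx_mulVl M (t : K) : expmx (t *: - M) *m expmx (t *: M) = 1%:M.
Proof. exact: mulmx1C (expmx_mulVr M t). Qed.

Lemma expmx_mul_eq0 M (t : K) (v : 'cV[K]_r) : expmx (t *: M) *m v = 0 -> v = 0.
Proof.
by move=> Mv; rewrite -[v]mul1mx -(expmx_mulVl M t) -mulmxA Mv mulmx0.
Qed.

End MatrixExponential.

(** * Quadratic forms, comparison of positive matrices and the resolvent estimate *)

Section QuadraticForms.
Context {K : realType} {r : nat}.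
Implicit Types (G H M N P Q : 'M[K]_r) (u v w x y : 'cV[K]_r).

Definition cdot u v : K := (u^T *m v) 0 0.

Lemma cdotE u v : cdot u v = \sum_i u i 0 * v i 0.
Proof. by rewrite /cdot mxE; apply: eq_bigr => i _; rewrite mxE. Qed.

Lemma cdotC u v : cdot u v = cdot v u.
Proof. by rewrite !cdotE; apply: eq_bigr => i _; rewrite mulrC. Qed.

Lemma cdotDr u v w : cdot u (v + w) = cdot u v + cdot u w.
Proof. by rewrite /cdot mulmxDr mxE. Qed.

Lemma cdotNr u v : cdot u (- v) = - cdot u v.
Proof. by rewrite /cdot mulmxN mxE. Qed.

Lemma cdotBr u v w : cdot u (v - w) = cdot u v - cdot u w.
Proof. by rewrite cdotDr cdotNr. Qed.

Lemma cdotBl u v w : cdot (v - w) u = cdot v u - cdot w u.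
Proof. by rewrite cdotC cdotBr !(cdotC u). Qed.

Lemma cdotDl u v w : cdot (v + w) u = cdot v u + cdot w u.
Proof. by rewrite cdotC cdotDr !(cdotC u). Qed.

Lemma cdotZr (a : K) u v : cdot u (a *: v) = a * cdot u v.
Proof. by rewrite /cdot -scalemxAr mxE. Qed.

Lemma cdotZl (a : K) u v : cdot (a *: u) v = a * cdot u v.
Proof. by rewrite cdotC cdotZr cdotC. Qed.

Lemma cdot_mull M u v : cdot (M *m u) v = cdot u (M^T *m v).
Proof. by rewrite /cdot trmx_mul mulmxA. Qed.

Lemma cdot_congr M N v :
  cdot v (N^T *m M *m N *m v) = cdot (N *m v) (M *m (N *m v)).
Proof. by rewrite cdot_mull !mulmxA. Qed.

Lemma cdot_ge0 u : 0 <= cdot u u.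
Proof. by rewrite cdotE; apply: sumr_ge0 => i _; rewrite -expr2 sqr_ge0. Qed.

Lemma cdot_gt0 u : u != 0 -> 0 < cdot u u.
Proof.
move=> u0; rewrite lt_def cdot_ge0 andbT; apply: contra u0 => /eqP.
rewrite cdotE => /psumr_eq0P uu; apply/eqP/matrixP => i j.
rewrite ord1 mxE; apply/eqP; rewrite -sqrf_eq0 expr2 uu//.
by move=> k _; rewrite -expr2 sqr_ge0.
Qed.

Lemma quad_cdot M v : (v^T *m M *m v) 0 0 = cdot v (M *m v).
Proof. by rewrite /cdot mulmxA. Qed.

Lemma cdot_mul_le M :
  exists2 b : K, 0 < b & forall v, cdot v (M *m v) <= b * cdot v v.
Proof.
have coord v i : v i 0 ^+ 2 <= cdot v v.
  rewrite cdotE (bigD1 i)//= -expr2 lerDl.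
  by apply: sumr_ge0 => k _; rewrite -expr2 sqr_ge0.
(* The leading [1] makes the constant strictly positive even for [M = 0], so that later proofs can
   divide by it. *)
exists (1 + \sum_i \sum_j `|M i j|) => [|v].
  by rewrite ltr_pwDl// sumr_ge0// => i _; exact: sumr_ge0.
rewrite mulrDl mul1r -[leLHS]add0r lerD ?cdot_ge0// {1}cdotE mulr_suml.
apply: ler_sum => i _; rewrite mxE mulr_sumr mulr_suml; apply: ler_sum => j _.
rewrite mulrCA (le_trans (ler_norm _))// normrM ler_wpM2l//.
rewrite ler_norml; have := coord v i; have := coord v j.
have := sqr_ge0 (v i 0 + v j 0); have := sqr_ge0 (v i 0 - v j 0); lra.
Qed.

Lemma mulmx_inj_unitmx M : (forall v, M *m v = 0 -> v = 0) -> M \in unitmx.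
Proof.
move=> Minj; rewrite -unitmx_tr -row_free_unit -kermx_eq0.
apply/rowV0P => v /sub_kermxP vM; apply: trmx_inj; rewrite trmx0.
by apply: Minj; apply: trmx_inj; rewrite trmx_mul trmxK vM trmx0.
Qed.

Lemma symmetric_pd_unitmx M : symmetric_pd M -> M \in unitmx.
Proof.
move=> [_ Mpd]; apply: mulmx_inj_unitmx => v Mv.
apply: contrapT => /eqP/Mpd; rewrite quad_cdot Mv.
by rewrite cdotE big1 ?ltxx// => i _; rewrite mxE mulr0.
Qed.

Lemma symmetric_pd_psd M : symmetric_pd M -> symmetric_psd M.
Proof.
move=> [Msym Mpd]; split=> // v; have [->|/Mpd/ltW//] := eqVneq v 0.
by rewrite mulmx0 mxE.
Qed.

Lemma symmetric_pd_invmx M : symmetric_pd M -> symmetric_pd (invmx M).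
Proof.
move=> Mpd; have uM := symmetric_pd_unitmx Mpd; have [Msym Mpos] := Mpd.
have Msym' : (invmx M)^T = invmx M by rewrite trmx_inv Msym.
split=> // v v0.
have := Mpos (invmx M *m v).
rewrite !quad_cdot mulKVmx// cdotC; apply.
by apply: contra v0 => /eqP Mv; rewrite -[v](mulKVmx uM) Mv mulmx0.
Qed.

(** No eigenvalues are used: if v' M^-1 v <= b v'v for all v, expanding the nonnegative value of the
    form of [M] at [b *: v - invmx M *m v] gives v'v <= b v'Mv. *)
Lemma symmetric_pd_ge M : symmetric_pd M ->
  exists2 c : K, 0 < c & forall v, c * cdot v v <= cdot v (M *m v).
Proof.
move=> Mpd; have uM := symmetric_pd_unitmx Mpd; have [Msym _] := Mpd.
have [_ Mpos] := symmetric_pd_psd Mpd.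
have [b b0 Hb] := cdot_mul_le (invmx M).
exists b^-1 => [|v]; first by rewrite invr_gt0.
rewrite ler_pdivrMl//; have bv := Hb v.
have := Mpos (b *: v - invmx M *m v).
rewrite quad_cdot mulmxBr mulKVmx// -scalemxAr cdotBr !cdotBl.
rewrite !(cdotZl, cdotZr) [cdot (invmx M *m v) v]cdotC.
rewrite [cdot (invmx M *m v) (M *m v)]cdotC cdot_mull Msym mulKVmx//.
by move=> Mbv; rewrite -(ler_pM2l b0); lra.
Qed.

Lemma symmetric_pd_dominates M N : symmetric_pd M ->
  exists2 c : K, 0 < c & forall v, c * cdot v (N *m v) <= cdot v (M *m v).
Proof.
move=> /symmetric_pd_ge[a a0 Ha]; have [b b0 Hb] := cdot_mul_le N.
exists (a / b) => [|v]; first by rewrite divr_gt0.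
rewrite (le_trans _ (Ha v))// -mulrA ler_wpM2l ?(ltW a0)//.
by rewrite ler_pdivrMl.
Qed.

(* Testing [x + (Q - P) G x = y] against [g = G x] controls [g], because
   [0 <= (x - P g)' G (x - P g)] and [G <= (1 - c) P^-1] give
   [x' g >= (1 + c) g' P g]. *)
Lemma resolvent_bound P Q (c : K) :
  symmetric_pd P -> symmetric_psd Q -> 0 < c ->
  exists2 k : K, 0 <= k & forall G, symmetric_psd G ->
    (forall v, c * cdot v (invmx P *m v) <=
       cdot v (invmx P *m v) - cdot v (G *m v)) ->
    forall x y, x + (Q - P) *m G *m x = y -> cdot x x <= k * cdot y y.
Proof.
move=> Ppd [_ Qpos] c0.
have uP := symmetric_pd_unitmx Ppd; have [Psym _] := Ppd.
have [p p0 Hp] := symmetric_pd_ge Ppd.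
have [b b0 Hb] := cdot_mul_le ((Q - P)^T *m (Q - P)).
have cp0 : 0 < c * p by rewrite mulr_gt0.
(* With z = (Q - P) g one has x = y - z, so |x|^2 <= 2 |y|^2 + 2 |z|^2, while |z|^2 <= b |g|^2 and
   (c p)^2 |g|^2 <= |y|^2. *)
exists (2 + 2 * (b / (c * p) ^+ 2)) => [|G [Gsym Gpos] HG x y xy].
  by rewrite addr_ge0// mulr_ge0// divr_ge0 ?(ltW b0)// sqr_ge0.
pose g := G *m x; pose w := P *m g.
have wg : cdot w g = cdot g (P *m g) by rewrite cdotC.
have xg : (1 + c) * cdot g (P *m g) <= cdot x g.
  have := Gpos (x - w); have := HG w.
  rewrite quad_cdot mulmxBr cdotBr !cdotBl -/g /w mulKmx// -/w.
  have -> : cdot x (G *m w) = cdot w g by rewrite cdotC cdot_mull Gsym.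
  by rewrite -wg; lra.
have gy : cdot g y = cdot x g + cdot g (Q *m g) - cdot g (P *m g).
  by rewrite -xy cdotDr (cdotC g x) -mulmxA mulmxBl cdotBr addrA.
have Qg := Qpos g; rewrite quad_cdot in Qg.
have Pg : c * p * cdot g g <= c * cdot g (P *m g).
  by rewrite -mulrA ler_wpM2l ?(ltW c0).
(* Expand 0 <= |c p g - y|^2 and use g'y >= c g'Pg >= c p |g|^2. *)
have gg : (c * p) ^+ 2 * cdot g g <= cdot y y.
  have := cdot_ge0 ((c * p) *: g - y).
  rewrite cdotBr !cdotBl !(cdotZl, cdotZr) (cdotC y g).
  have : c * p * (c * p * cdot g g) <= c * p * cdot g y.
    by rewrite ler_wpM2l ?(ltW cp0)//; lra.
  by rewrite expr2; lra.
pose z := (Q - P) *m g.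
have zz : cdot z z <= b / (c * p) ^+ 2 * cdot y y.
  rewrite /z cdot_mull mulmxA (le_trans (Hb g))// -mulrA ler_wpM2l ?(ltW b0)//.
  by rewrite ler_pdivlMl ?exprn_gt0.
have -> : x = y - z by rewrite -xy /z /g mulmxA addrK.
have := cdot_ge0 (y + z); move: zz.
rewrite cdotBr !cdotBl cdotDr !cdotDl (cdotC z y).
move: (b / _) => b' zz yz; lra.
Qed.

Lemma spectral_norm_le M (k : K) : 0 <= k ->
  (forall v, cdot (M *m v) (M *m v) <= k * cdot v v) ->
  spectral_norm M <= Num.sqrt k.
Proof.
move=> k0 HM; apply: ge_sup.
  exists (euclidean_norm (M *m 0)); exists 0 => //=.
  by rewrite /euclidean_norm mulmx0 mxE sqrtr0.
move=> _ [v /= v1 <-]; rewrite /euclidean_norm ler_wsqrtr//.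
rewrite (le_trans (HM v))// ler_piMr//.
by rewrite -(sqr_sqrtr (cdot_ge0 v)) expr_le1// sqrtr_ge0.
Qed.

End QuadraticForms.

(** * Gramians and the dual form of controllability *)

Section Gramian.
Context {K : realType} {r : nat}.
Implicit Types (A B P R S : 'M[K]_r) (v : 'cV[K]_r).

Lemma is_derive_quad (X : K -> 'M[K]_r) (D : 'M[K]_r) v (t : K) :
  is_derive t 1 X D ->
  is_derive t 1 (fun s => cdot v (X s *m v)) (cdot v (D *m v)).
Proof.
move=> dX; have := is_derive_mulmxl v^T (is_derive_mulmxr v dX).
by move=> /is_derive_mxP/(_ 0 0).
Qed.

Lemma continuous_quad (X : K -> 'M[K]_r) v :
  continuous X -> continuous (fun s => cdot v (X s *m v)).
Proof.
move=> cX; have cXv : continuous (fun s => X s *m v).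
  exact: (continuous_mulmx cX (@cst_continuous K _ v)).
have := continuous_mulmx (@cst_continuous K _ v^T) cXv.
by move=> /continuous_mxP/(_ 0 0).
Qed.

Lemma gramian_exists B S : S^T = S -> exists G : K -> 'M[K]_r,
  [/\ continuous G, G 0 = 0,
      forall t : K, 0 < t ->
        is_derive t 1 G ((expmx (t *: B))^T *m S *m expmx (t *: B)) &
      forall t, 0 <= t -> (G t)^T = G t].
Proof.
move=> Ssym; pose g t := (expmx (t *: B))^T *m S *m expmx (t *: B).
have cg : continuous g.
  have ce := @continuous_expmx K r B.
  have cS := continuous_mulmx (continuous_trmx ce) (@cst_continuous K _ S).
  exact: (continuous_mulmx cS ce).
have /choice[F HF] (ij : 'I_r * 'I_r) : exists F : K -> K,
    [/\ continuous F, F 0 = 0 &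
    forall t : K, 0 < t -> is_derive t 1 F (g t ij.1 ij.2)].
  by apply: continuous_primitive; move/continuous_mxP: cg; exact.
pose G t := \matrix_(i, j) F (i, j) t.
have GE i j : (fun t => G t i j) = F (i, j) by apply/funext => t; rewrite mxE.
have cG : continuous G.
  by apply/continuous_mxP => i j; rewrite GE; case: (HF (i, j)).
have G0 : G 0 = 0 by apply/matrixP => i j; rewrite !mxE; case: (HF (i, j)).
have dG (t : K) : 0 < t -> is_derive t 1 G (g t).
  move=> t0; apply/is_derive_mxP => i j; rewrite GE.
  by have [_ _ /(_ _ t0)] := HF (i, j).
exists G; split=> // t t0; apply/eqP; rewrite -subr_eq0; apply/eqP.
pose W t := (G t)^T - G t.
have cW : continuous W.
  by move=> s; apply: cvgB; [exact: continuous_trmx|exact: cG].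
have W0 : W 0 = 0 by rewrite /W G0 trmx0 subrr.
(* [W' = 0] is established at positive times; read as a linear equation with zero coefficient, it
   falls under [linear_ode_eq0]. *)
have c0 : continuous (cst 0 : K -> 'M[K]_r) by exact: cst_continuous.
suff dW (s : K) : 0 < s -> is_derive s 1 W (cst 0 s *m W s).
  exact: (linear_ode_eq0 c0 cW W0 dW).
move=> s0.
apply: (is_derive_eq (is_deriveB (is_derive_trmx (dG _ s0)) (dG _ s0))).
by rewrite /g !trmx_mul trmxK Ssym mulmxA subrr mul0mx.
Qed.

(** Full row rank means that the controllability matrix has trivial left kernel; transposing the
    hypothesis puts [w^T] in that kernel. *)
Lemma controllable_inj A M (w : 'cV[K]_r) : controllable A M ->
  (forall k, M^T *m (A^T) ^+ k *m w = 0) -> w = 0.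
Proof.
move=> AM Mw; have fM : row_free (\mxrow_(k < r) (A ^+ k *m M)).
  by rewrite /row_free AM.
apply: trmx_inj; apply: (row_free_inj fM).
rewrite trmx0 mul0mx mul_mxrow -[RHS]mxrow0; apply/eq_mxrow => k.
apply: trmx_inj; rewrite trmx0 !trmx_mul trmxK.
by rewrite -[RHS](Mw k); congr (_ *m _ *m _); elim: (nat_of_ord k) => [|n IHn];
  rewrite ?expr0 ?trmx1// exprS exprSr -!mulmxE trmx_mul IHn.
Qed.

End Gramian.

(** * The uniform bound on the Gramian at the fixed point *)

Section RiccatiFixedPoint.
Context {K : realType} {r : nat}.
Implicit Types (A B P Q R S : 'M[K]_r) (v : 'cV[K]_r).

(** Conjugation of the Riccati equation by P^-1, solved for the closed-loop term. It yields both the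
    Lyapunov equation for P^-1 and the differential equation of P^-1 e^{tB} v. *)
Lemma riccati_invmx A R S P : P \in unitmx -> riccati A R S P = 0 ->
  invmx P *m (A - P *m S) =
  - (A^T *m invmx P + invmx P *m R *m invmx P).
Proof.
move=> uP PR; apply/eqP; rewrite -addr_eq0; apply/eqP.
have := congr1 (fun X => invmx P *m X *m invmx P) PR.
rewrite /riccati mulmx0 mul0mx => <-.
rewrite !(mulmxBr, mulmxDr, mulmxBl, mulmxDl) -!mulmxA !mulKmx//.
rewrite mulmxV// !mulmx1 !mulmxA.
by rewrite addrAC -!addrA; congr (_ + _); rewrite addrC !addrA addrAC.
Qed.

(* With [G' = (e^{tB})' S e^{tB}], the matrix
   [H = P^-1 - G - (e^{tB})' P^-1 e^{tB}] is the Gramian of [P^-1 R P^-1];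
   controllability makes [H 1] positive definite. *)
Lemma gramian_bound A R S Rh P (G : K -> 'M[K]_r) :
  let B := A - P *m S in
  symmetric_psd S -> symmetric_sqrt R Rh ->
  controllable A Rh -> symmetric_pd P -> riccati A R S P = 0 ->
  continuous G -> G 0 = 0 -> (forall t, 0 <= t -> (G t)^T = G t) ->
  (forall t : K, 0 < t ->
    is_derive t 1 G ((expmx (t *: B))^T *m S *m expmx (t *: B))) ->
  (forall t, 0 <= t -> symmetric_psd (G t)) /\
  exists2 c : K, 0 < c & forall t v, 0 <= t ->
    c * cdot v (invmx P *m v) <= cdot v (invmx P *m v) - cdot v (G t *m v).
Proof.
move=> B [Ssym Spos] [Rhsym RhE] AR Ppd PR cG G0 Gsym dG.
have uP := symmetric_pd_unitmx Ppd.
have [Pisym Pipos] := symmetric_pd_psd (symmetric_pd_invmx Ppd).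
pose e (t : K) := expmx (t *: B).
have de (t : K) : is_derive t 1 e (B *m e t) by exact: is_derive_expmx.
have ce : continuous e := @continuous_expmx K r B.
have Gle s t v : 0 <= s -> s <= t -> cdot v (G s *m v) <= cdot v (G t *m v).
  move=> s0 st.
  have dq (x : K) : s < x < t -> is_derive x 1 (fun y => cdot v (G y *m v))
      (cdot v ((e x)^T *m S *m e x *m v)).
    by move=> /andP[sx _]; apply: is_derive_quad; exact: dG (le_lt_trans s0 sx).
  apply: (derive_ge0_le st (continuous_quad cG) dq) => x _.
  by rewrite cdot_congr -quad_cdot.
have Gpsd t : 0 <= t -> symmetric_psd (G t).
  move=> t0; split=> [|v]; first exact: Gsym.
  have := Gle 0 t v (lexx 0) t0.
  by rewrite G0 mul0mx /cdot mulmx0 mxE mulmxA.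
split=> //.
pose V (t : K) := (e t)^T *m invmx P *m e t.
pose H (t : K) := invmx P - G t - V t.
pose w v (t : K) := invmx P *m e t *m v.
have dV (t : K) : is_derive t 1 V
    ((e t)^T *m (B^T *m invmx P + invmx P *m B) *m e t).
  apply: (is_derive_eq
    (is_derive_mulmx (is_derive_mulmxr _ (is_derive_trmx (de t))) (de t))).
  by rewrite trmx_mul mulmxDr mulmxDl !mulmxA.
have PB := riccati_invmx uP PR.
(* In the derivative of [H], this Lyapunov equation cancels the [S] terms of [G] and [V] and leaves
   only the [R] term. *)
have lyap : B^T *m invmx P + invmx P *m B = - (S + invmx P *m R *m invmx P).
  rewrite PB /B linearB/= trmx_mul Ssym (symmetric_pd_psd Ppd).1.
  rewrite mulmxBl mulmxK// !opprD addrA; congr (_ - _).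
  by rewrite addrAC subrr sub0r.
have dH (t : K) : 0 < t ->
    is_derive t 1 H ((e t)^T *m (invmx P *m R *m invmx P) *m e t).
  move=> t0.
  apply: (is_derive_eq (is_deriveB
    (is_deriveB (is_derive_cst (invmx P) t 1) (dG t t0)) (dV t))).
  rewrite lyap mulmxN mulNmx opprK mulmxDr mulmxDl sub0r addrA.
  by rewrite -/(e t) addNr add0r.
have cV : continuous V by exact: is_derive_continuous dV.
have cH : continuous H.
  move=> t; apply: cvgB; last exact: cV.
  by apply: cvgB; [exact: cvg_cst|exact: cG].
have H0 : H 0 = 0.
  by rewrite /H /V G0 subr0 /e scale0r expmx0 trmx1 mul1mx mulmx1 subrr.
have dHq v (t : K) : 0 < t -> is_derive t 1 (fun s => cdot v (H s *m v))
    (cdot (Rh *m w v t) (Rh *m w v t)).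
  move=> t0; apply: (is_derive_eq (is_derive_quad v (dH t t0))).
  rewrite cdot_congr -{1}Pisym cdot_congr -RhE -{1}Rhsym.
  by rewrite -mulmxA -cdot_mull /w !mulmxA.
have Hmono v (a b : K) : 0 <= a -> a <= b ->
    cdot v (H a *m v) <= cdot v (H b *m v).
  move=> a0 ab; pose dq s := cdot (Rh *m w v s) (Rh *m w v s).
  apply: (@derive_ge0_le _ (fun s => cdot v (H s *m v)) dq a b ab
    (continuous_quad cH)).
    by move=> t /andP[a_t _]; apply: dHq; exact: le_lt_trans a0 a_t.
  by move=> t _; exact: cdot_ge0.
have H1pd : symmetric_pd (H 1).
  split.
    rewrite /H /V !linearB/= Gsym// Pisym; congr (_ - _).
    by rewrite !trmx_mul trmxK Pisym mulmxA.
  (* If v' H_1 v <= 0, monotonicity from H_0 = 0 makes v' H_t v vanish on [0, 1], hence also its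
     derivative |Rh w|^2 inside. *)
  move=> v v0; rewrite quad_cdot ltNge; apply/negP => H1v.
  have Hv0 (t : K) : 0 <= t <= 1 -> cdot v (H t *m v) = 0.
    move=> /andP[t0 t1]; apply/eqP.
    rewrite eq_le (le_trans (Hmono v t 1 t0 t1))//=.
    have := Hmono v 0 t (lexx 0) t0.
    by rewrite H0 mul0mx {1}/cdot mulmx0 mxE.
  have near01 (t : K) (Z : K -> Prop) : 0 < t < 1 ->
      (forall s, 0 < s < 1 -> Z s) -> \forall s \near t, Z s.
    move=> /andP[t0 t1] HZ; near=> s; apply: HZ; apply/andP; split.
      by near: s; exact: lt_nbhsr.
    by near: s; exact: lt_nbhsl.
  have Rw (t : K) : 0 < t < 1 -> Rh *m w v t = 0.
    move=> t01; have t0 : 0 < t by case/andP: t01.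
    apply: contrapT => /eqP/cdot_gt0.
    rewrite (near_eq0_derive0 (dHq v t t0)) ?ltxx//.
    apply: (near01 t _ t01) => s /andP[s0 s1].
    by apply: Hv0; rewrite !ltW.
  have dw (t : K) : is_derive t 1 (w v)
      (- (A^T *m w v t + invmx P *m Rh *m (Rh *m w v t))).
    apply: (is_derive_eq
      (is_derive_mulmxr v (is_derive_mulmxl (invmx P) (de t)))).
    rewrite !mulmxA PB mulNmx mulmxDl mulNmx mulmxDl.
    by rewrite -[R in LHS]RhE /w !mulmxA.
  (* Where Rh w = 0, the curve satisfies w' = - A^T w, so each differentiation of the identity
     brings out one more factor [A^T]. *)
  have RAw k : forall t : K, 0 < t < 1 -> Rh^T *m A^T ^+ k *m w v t = 0.
    elim: k => [t t01|k IHk t t01]; first by rewrite expr0 mulmx1 Rhsym Rw.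
    apply: oppr_inj; rewrite oppr0.
    apply: (@near_eq0_derive0 _ _ (fun s => Rh^T *m A^T ^+ k *m w v s) _ t).
      apply: (is_derive_eq (is_derive_mulmxl _ (dw t))).
      rewrite Rw// mulmx0 addr0 mulmxN exprSr -mulmxE.
      by rewrite !mulmxA.
    exact: (near01 t _ t01).
  (* Any interior time would do: w vanishes there, and invertibility of P^-1 and e^{tB} then gives v
     = 0, a contradiction. *)
  have h01 : 0 < (2^-1 : K) < 1 by rewrite invr_gt0 invf_lt1 ?ltr1n// ltr0n.
  have w0 : w v 2^-1 = 0.
    by apply: (controllable_inj AR) => k; exact: RAw.
  move/eqP: v0; apply; apply: (@expmx_mul_eq0 _ _ B 2^-1).
  by rewrite -[LHS](mulKVmx uP) [invmx P *m _]mulmxA [_ *m _ *m v]w0 mulmx0.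
have [c c0 Hc] := symmetric_pd_dominates (invmx P) H1pd.
exists c => // t v t0; apply: (le_trans (Hc v)).
have KE (s : K) : cdot v (invmx P *m v) - cdot v (G s *m v) =
    cdot v (H s *m v) + cdot v (V s *m v).
  by rewrite /H !mulmxBl !cdotBr subrK.
have Vpos (s : K) : 0 <= cdot v (V s *m v) by rewrite cdot_congr -quad_cdot.
(* For t >= 1, P^-1 - G_t = H_t + V_t >= H_1; for t <= 1, G_t <= G_1 reduces the claim to time 1. *)
have [t1|/ltW t1] := leP 1 t.
  by rewrite KE (le_trans (Hmono v 1 t ler01 t1))// lerDl Vpos.
apply: (@le_trans _ _ (cdot v (invmx P *m v) - cdot v (G 1 *m v))).
  by rewrite KE lerDl.
by rewrite lerB// Gle.
Unshelve. all: by end_near. Qed.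

End RiccatiFixedPoint.

(** * The flow around the fixed point and the factorisation of the semigroup *)

Section RiccatiFlow.
Context {K : realType} {r : nat}.
Implicit Types (A P Q R S X : 'M[K]_r).

(* Precomposing with the absolute value makes a solution on [0, +oo[ continuous
   on the whole line, so no one-sided derivative is needed afterwards. *)
Lemma ode_solution_normr (F : K -> 'M[K]_r -> 'M[K]_r) X0 (x : K -> 'M[K]_r) :
  ode_solution F X0 x ->
  [/\ continuous (fun t : K => x `|t|), x 0 = X0 &
      forall t : K, 0 < t ->
        is_derive t 1 (fun s : K => x `|s|) (F t (x `|t|))].
Proof.
move=> [x0 dx0 dx]; split=> //.
  have cpos (t : K) : t != 0 -> {for t, continuous (fun s : K => x `|s|)}.
    rewrite -normr_gt0 => /dx[dxt _].
    apply: continuous_comp; first exact: norm_continuous.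
    exact/differentiable_continuous/derivable1_diffP.
  move=> t; have [->|/cpos//] := eqVneq t 0.
  (* Right continuity at 0 follows from the one-sided derivative: the increment is h times a
     convergent quotient. *)
  have xr : x h @[h --> 0^'+] --> x 0.
    have hx : h *: (h^-1 *: (x h - x 0)) @[h --> 0^'+] --> 0 *: F 0 (x 0).
      have h0 : (h : K) @[h --> 0^'+] --> (0 : K).
        by apply: (@cvg_at_right_filter K K id); exact: cvg_id.
      exact: (cvgZ h0 dx0).
    rewrite scale0r in hx.
    have hxx : h *: (h^-1 *: (x h - x 0)) + x 0 @[h --> 0^'+] --> x 0.
      by rewrite -[X in _ --> X]add0r; apply: cvgD hx _; exact: cvg_cst.
    apply: cvg_trans hxx.
    apply: near_eq_cvg; near=> h.
    have hn0 : h != 0.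
      by rewrite gt_eqF//; near: h; exact: nbhs_right_gt.
    by rewrite scalerA mulfV// scale1r subrK.
  rewrite /continuous_at normr0.
  apply/cvgrPdist_le => eps eps0.
  have := (cvgrPdist_le _ _).1 xr _ eps0; rewrite near_withinE => x_near.
  have [d /= d0 Hd] := (nbhs_ballP _ _).1 (x_near _).
  apply/nbhs_ballP; exists d => //= s sd.
  have [->|s0] := eqVneq s 0; first by rewrite normr0 subrr normr0 ltW.
  apply: Hd; last by rewrite /= normr_gt0.
  by move: sd; rewrite /ball/= !sub0r !normrN normr_id.
move=> t t0; rewrite gtr0_norm//; apply: near_eq_is_derive (dx t t0).
near=> s; rewrite gtr0_norm//; near: s; exact: lt_nbhsr.
Unshelve. all: by end_near. Qed.

(** This asymmetric splitting gives the left coefficient of the equation for [E] and, on the right,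
    the constant [B^T]. *)
Lemma riccati_sub A R S P X : P^T = P -> S^T = S ->
  riccati A R S X - riccati A R S P =
  (A - X *m S) *m (X - P) + (X - P) *m (A - P *m S)^T.
Proof.
move=> Psym Ssym; rewrite /riccati [(A - P *m S)^T]linearB/= trmx_mul Psym Ssym.
rewrite !(mulmxBr, mulmxBl) !mulmxA.
move: (A *m X) (A *m P) (X *m A^T) (P *m A^T) (X *m S *m X) (P *m S *m P)
  (X *m S *m P) => a b c d f g h.
by apply/matrixP => i j; rewrite !mxE; ring.
Qed.

(** Multiplied on the right by (e^{-tB})^T, the difference [phi t - P] satisfies the same linear
    equation as [E t *m (Q - P)], with the same initial value; [F] measures the discrepancy. *)
Lemma riccati_flow_diff A R S P Q (phi E : K -> 'M[K]_r) :
  P^T = P -> S^T = S -> riccati A R S P = 0 ->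
  continuous phi -> continuous E -> phi 0 = Q -> E 0 = 1%:M ->
  (forall t : K, 0 < t -> is_derive t 1 phi (riccati A R S (phi t))) ->
  (forall t : K, 0 < t -> is_derive t 1 E ((A - phi t *m S) *m E t)) ->
  forall t : K, 0 <= t ->
    phi t - P = E t *m (Q - P) *m (expmx (t *: (A - P *m S)))^T.
Proof.
move=> Psym Ssym PR cphi cE phi0 E0 dphi dE t t0.
set B := A - P *m S; pose e (s : K) := expmx (s *: - B).
have de (s : K) : is_derive s 1 e (- B *m e s) by exact: is_derive_expmx.
pose F s := (phi s - P) *m (e s)^T - E s *m (Q - P).
have dF (s : K) : 0 < s -> is_derive s 1 F ((A - phi s *m S) *m F s).
  move=> s0.
  have dphiP := is_deriveB (dphi s s0) (is_derive_cst P s 1).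
  apply: (is_derive_eq (is_deriveB
    (is_derive_mulmx dphiP (is_derive_trmx (de s)))
    (is_derive_mulmxr (Q - P) (dE s s0)))).
  rewrite /F [RHS]mulmxBr !mulmxA -[(phi - cst P) s]/(phi s - P); congr (_ - _).
  have -> : riccati A R S (phi s) - 0 = (A - phi s *m S) *m (phi s - P) +
      (phi s - P) *m B^T by rewrite -PR riccati_sub.
  rewrite expmxZ_comm trmx_mul linearN/=.
  by rewrite mulmxDl mulNmx mulmxN mulmxA addrK.
have cF : continuous F.
  have cphiP : continuous (fun s => phi s - P).
    by move=> s; apply: cvgB; [exact: cphi|exact: cvg_cst].
  move=> s; apply: cvgB.
    exact: (continuous_mulmx cphiP (continuous_trmx (is_derive_continuous de))).
  exact: (continuous_mulmx cE (@cst_continuous K _ (Q - P))).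
have F0 : F 0 = 0.
  by rewrite /F phi0 E0 /e scale0r expmx0 trmx1 mulmx1 mul1mx subrr.
have cU : continuous (fun s => A - phi s *m S).
  move=> s; apply: cvgB; first exact: cvg_cst.
  exact: (continuous_mulmx cphi (@cst_continuous K _ S)).
have /eqP := linear_ode_eq0 cU cF F0 dF t0.
rewrite subr_eq0 => /eqP <-.
by rewrite -mulmxA -trmx_mul expmx_mulVr trmx1 mulmx1.
Qed.

(** With Y = 1 + (Q - P) G and M = Y', the defect W = 1 - X Y solves the linear equation W' = - X M
    W with W(0) = 0. Invertibility of [Y] is then a consequence of X Y = 1. *)
Lemma exponential_semigroup_factor A R S P Q (phi E G : K -> 'M[K]_r) :
  let B := A - P *m S in
  P^T = P -> S^T = S -> riccati A R S P = 0 ->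
  continuous phi -> continuous E -> phi 0 = Q -> E 0 = 1%:M ->
  (forall t : K, 0 < t -> is_derive t 1 phi (riccati A R S (phi t))) ->
  (forall t : K, 0 < t -> is_derive t 1 E ((A - phi t *m S) *m E t)) ->
  continuous G -> G 0 = 0 ->
  (forall t : K, 0 < t ->
    is_derive t 1 G ((expmx (t *: B))^T *m S *m expmx (t *: B))) ->
  forall t, 0 <= t ->
    1%:M + (Q - P) *m G t \in unitmx /\
    E t = expmx (t *: B) *m invmx (1%:M + (Q - P) *m G t).
Proof.
move=> B Psym Ssym PR cphi cE phi0 E0 dphi dE cG G0 dG t t0.
have phiP := riccati_flow_diff Psym Ssym PR cphi cE phi0 E0 dphi dE.
pose f (s : K) := expmx (s *: B).
pose e (s : K) := expmx (s *: - B).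
have de (s : K) : is_derive s 1 e (- B *m e s) by exact: is_derive_expmx.
have ce : continuous e by exact: is_derive_continuous de.
have cf : continuous f by exact: continuous_expmx.
have feK s : f s *m (e s *m E s) = E s by rewrite mulmxA expmx_mulVr mul1mx.
pose X s := e s *m E s.
pose M s := (Q - P) *m ((f s)^T *m S *m f s).
pose Y s := 1%:M + (Q - P) *m G s.
have dX (s : K) : 0 < s -> is_derive s 1 X (- (X s *m M s *m X s)).
  move=> s0; apply: (is_derive_eq (is_derive_mulmx (de s) (dE s s0))).
  have -> : - B *m e s = e s *m - B by exact: expmxZ_comm.
  rewrite -[e s *m _ *m _]mulmxA -mulmxDr -mulmxDl.
  (* The flow now enters only through [phi s - P], which [phiP] turns into E (Q - P) f^T; writing
     the remaining [E] as f X produces X M X. *)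
  have -> : - B + (A - phi s *m S) = - ((phi s - P) *m S).
    by rewrite /B mulmxBl !opprB addrA subrK.
  rewrite phiP ?ltW// mulNmx mulmxN -{2}(feK s); congr (- _).
  by rewrite /X /M !mulmxA.
have dY (s : K) : 0 < s -> is_derive s 1 Y (M s).
  move=> s0; apply: (is_derive_eq (is_deriveD (is_derive_cst 1%:M s 1)
    (is_derive_mulmxl (Q - P) (dG s s0)))).
  by rewrite add0r.
pose W s := 1%:M - X s *m Y s.
have dW (s : K) : 0 < s -> is_derive s 1 W (- (X s *m M s) *m W s).
  move=> s0; apply: (is_derive_eq (is_deriveB (is_derive_cst 1%:M s 1)
    (is_derive_mulmx (dX s s0) (dY s s0)))).
  by rewrite /W sub0r mulmxBr mulmx1 !mulNmx !opprD !opprK addrC !mulmxA.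
have cX : continuous X by exact: (continuous_mulmx ce cE).
have cY : continuous Y.
  move=> s; apply: cvgD; first exact: cvg_cst.
  exact: (continuous_mulmx (@cst_continuous K _ (Q - P)) cG).
have cM : continuous M.
  have cfS := continuous_mulmx (continuous_trmx cf) (@cst_continuous K _ S).
  have cfSf := continuous_mulmx cfS cf.
  exact: (continuous_mulmx (@cst_continuous K _ (Q - P)) cfSf).
have cW : continuous W.
  by move=> s; apply: cvgB; [exact: cvg_cst|exact: (continuous_mulmx cX cY)].
have cU : continuous (fun s => - (X s *m M s)).
  by move=> s; apply: cvgN; exact: (continuous_mulmx cX cM).
have W0 : W 0 = 0.
  by rewrite /W /X /Y G0 E0 /e scale0r expmx0 mulmx0 addr0 !mulmx1 subrr.
have /eqP := linear_ode_eq0 cU cW W0 dW t0.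
rewrite subr_eq0 eq_sym => /eqP XY.
have [uX uY] := mulmx1_unit XY; split=> //.
have -> : invmx (Y t) = X t by rewrite -[RHS](mulmxK uY) XY mul1mx.
by rewrite feK.
Qed.

End RiccatiFlow.

(** * The affine factor, its uniform bound and its value at the fixed point *)

Theorem theorem1p1 (K : realType) (r : nat) (hr : (0 < r)%N)
    (A R S Rh Sh : 'M[K]_r)
    (hR : symmetric_psd R) (hS : symmetric_psd S)
    (hRh : symmetric_sqrt R Rh) (hSh : symmetric_sqrt S Sh)
    (hobs : observable A Sh) (hctrl : controllable A Rh)
    (phi E : K -> 'M[K]_r -> 'M[K]_r)
    (hphi : riccati_flow A R S phi)
    (hE : exponential_semigroup A S phi E)
    (Pinf : 'M[K]_r) (hPinf : riccati_fixed_point A R S Pinf) :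
  let B := A - Pinf *m S in
  (exists C : K -> 'M[K]_r -> 'M[K]_r,
    (forall t : K, 0 <= t ->
      affine_on [set Q | symmetric_psd Q] (C t) /\
      (forall Q, symmetric_psd Q -> C t Q \in unitmx)) /\
    (forall (t : K) (Q : 'M[K]_r), 0 <= t -> symmetric_psd Q ->
      [/\ E t Q = expmx (t *: B) *m invmx (C t Q),
          (ereal_sup [set (spectral_norm (invmx (C u Q)))%:E
                     | u in [set u : K | (0 <= u)%R]] < +oo)%E &
          C t Pinf = 1%:M])) /\
  (forall t : K, 0 <= t -> E t Pinf = expmx (t *: B)).
Proof.
move=> B; have [Ppd PR _] := hPinf; have [Psym _] := Ppd; have [Ssym _] := hS.
have [G [cG G0 dG Gsym]] := gramian_exists B Ssym.
have [Gpsd [c c0 Gc]] :=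
  gramian_bound hS hRh hctrl Ppd PR cG G0 Gsym dG.
pose C t Q := 1%:M + (Q - Pinf) *m G t.
have CE t Q : 0 <= t -> symmetric_psd Q ->
    C t Q \in unitmx /\ E t Q = expmx (t *: B) *m invmx (C t Q).
  move=> t0 Qpsd.
  have [cphi phi0 dphi] := ode_solution_normr (hphi Q Qpsd).2.
  have [cE E0 dE] := ode_solution_normr (hE Q Qpsd).
  (* The time in the coefficient is also put in absolute value, to match the extension of [phi] that
     is continuous on the whole line. *)
  have dE' (s : K) : 0 < s -> is_derive s 1 (fun s : K => E `|s| Q)
      ((A - phi `|s| Q *m S) *m E `|s| Q).
    by move=> s0; rewrite {1}(gtr0_norm s0); exact: dE.
  have phi0' : phi `|(0 : K)| Q = Q by rewrite normr0.
  have E0' : E `|(0 : K)| Q = 1%:M by rewrite normr0.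
  have := exponential_semigroup_factor Psym Ssym PR cphi cE phi0' E0' dphi dE'
    cG G0 dG t0.
  by rewrite ger0_norm.
have CP t : C t Pinf = 1%:M by rewrite /C subrr mul0mx addr0.
split; last first.
  move=> t t0; have [_ ->] := CE t Pinf t0 (symmetric_pd_psd Ppd).
  by rewrite CP invmx1 mulmx1.
exists C; split=> [t t0|t Q t0 Qpsd].
  split=> [|Q Qpsd]; last by have [] := CE t Q t0 Qpsd.
  exists (mulmxr (G t)), (1%:M - Pinf *m G t) => Q _.
  by rewrite /C mulmxBl /= addrCA.
split; [by have [] := CE t Q t0 Qpsd| |exact: CP].
(* [k] depends on [Q] but not on the time, hence bounds the supremum; it is applied below to x =
   C_u(Q)^-1 v and y = v. *)
have [k k0 Hk] := resolvent_bound Ppd Qpsd c0.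
apply: (@le_lt_trans _ _ (Num.sqrt k)%:E); last exact: ltry.
apply: ub_ereal_sup => _ [u /= u0 <-]; rewrite lee_fin.
apply: spectral_norm_le => // v.
have [uC _] := CE u Q u0 Qpsd.
apply: (Hk (G u) (Gpsd u u0) (fun v => Gc u v u0)).
by rewrite -[RHS](mulKVmx uC) /C [RHS]mulmxDl mul1mx.
Qed.
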